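(* Let $J:C[0,1]\rightrightarrows rca[0,1]$ be the normalized duality mapping of the real Banach space $C[0,1]$. Let $\lambda\in rca[0,1]$. If $\lambda[0,1]\neq0$, then for any $f\in C[0,1]$ there is $\mu\in J(f)$ such that $$\lambda\notin\widehat{D}^*J(f,\mu)(\theta^{**}).$$ In particular, if $\lambda[0,1]\ne0$, then $$\lambda\notin\widehat{D}^*J(\theta,\theta^* )(\theta^{**}).$$
   Context: $C[0,1]$ is the Banach space of continuous real functions on $[0,1]$ with the maximum norm $\|\cdot\|$; its dual $C^*[0,1]=rca[0,1]$ is the space of regular countably additive real-valued measures on the Borel $\sigma$-field $\Sigma$ of $[0,1]$, with pairing $\langle\mu,f\rangle=\int_0^1 f(s)\,\mu(ds)$ and norm $\|\mu\|_*=v(\mu,[0,1])$, the total variation of $\mu$ (the dual norm). $\lambda[0,1]$ denotes the value of the measure $\lambda$ on the set $[0,1]$. $rca^*[0,1]=C^{**}[0,1]$ is the dual of $rca[0,1]$, with pairing $\langle\cdot,\cdot\rangle_*$. $\theta,\theta^*,\theta^{**}$ are the origins of $C[0,1],rca[0,1],rca^*[0,1]$. The normalized duality mapping is $J(f)=\{\mu\in rca[0,1]:\langle\mu,f\rangle=\|f\|^2=\|\mu\|_*^2\}$. For $\mu\in J(f)$, the Mordukhovich derivative of $J$ at $(f,\mu)$ is defined, for $\Phi\in C^{**}[0,1]$, by $$\widehat{D}^*J(f,\mu)(\Phi)=\left\{\lambda\in rca[0,1]:\ \limsup_{(g,\gamma)\to(f,\mu),\ g\in C[0,1],\ \gamma\in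 J(g)}\frac{\langle\lambda,g-f\rangle-\langle\Phi,\gamma-\mu\rangle_*}{\|g-f\|+\|\gamma-\mu\|_*}\le0\right\},$$ with convergence in the norms and $(g,\gamma)\neq(f,\mu)$. *)

(* Defs.v *)
From HB Require Import structures.
From mathcomp Require Import all_boot all_order all_algebra.
From mathcomp Require Import all_classical all_reals all_analysis.

Set Implicit Arguments.
Unset Strict Implicit.
Unset Printing Implicit Defensive.

Import Order.TTheory GRing.Theory Num.Theory.
Import numFieldNormedType.Exports.

Local Open Scope classical_set_scope.
Local Open Scope ring_scope.

Definition I01 (R : realType) : Type := set_type `[0 : R, 1]%classic.

HB.instance Definition _ (R : realType) := PseudoMetric.on (I01 R).

Section I01_structures.
Variable R : realType.

Fact I01_0_subproof : (0 : R) \in `[0 : R, 1]%classic.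
Proof. by apply/mem_set; rewrite /= in_itv /= lexx ler01. Qed.

HB.instance Definition _ :=
  isPointed.Build (I01 R) (exist _ (0 : R) I01_0_subproof).

(* The Borel sigma-field: generated by the relatively open subsets. *)
HB.instance Definition _ :=
  Measurable.copy (I01 R) (g_sigma_algebraType (@open (I01 R))).

End I01_structures.

Section C01.
Variable R : realType.

Definition is_C01 : {pred I01 R -> R} :=
  [pred f : I01 R -> R | `[< continuous f >]].

Record C01 : predArgType :=
  MkC01 { C01_fun :> I01 R -> R ; _ : C01_fun \in is_C01 }.

HB.instance Definition _ := [isSub for C01_fun].
HB.instance Definition _ := [Choice of C01 by <:].

Lemma C01_continuous (f : C01) : continuous f.
Proof. by case: f => f /= /asboolP. Qed.

Fact is_C01_submod_closed : submod_closed is_C01.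
Proof.
split; first by apply/asboolP => x; exact: cst_continuous.
move=> a f g /asboolP cf /asboolP cg; apply/asboolP => x.
apply: (@continuousD R R (I01 R)) (cg x).
exact: (@continuousZl_tmp R R (I01 R)) (cf x).
Qed.

HB.instance Definition _ :=
  GRing.isSubmodClosed.Build R _ is_C01 is_C01_submod_closed.
HB.instance Definition _ := [SubChoice_isSubLmodule of C01 by <:].

Definition maxnorm (f : C01) : R := sup [set `|f x| | x in [set: I01 R]].

Lemma C01_max_attained (f : C01) : exists x, forall y, `|f y| <= `|f x|.
Proof.
pose g (x : I01 R) := `|f x|; pose h := valL g.
have cg : continuous g.
  by move=> x; apply: continuous_comp (@C01_continuous f x) _; exact: norm_continuous.
have hg y : h (val y) = g y.
  by have /(congr1 (fun k => k y)) := @valLK _ _ point `[0 : R, 1]%classic g.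
have [||c c01 cmax] := @EVT_max R h 0 1; first exact: ler01.
  exact/subspace_valL_continuousP.
have c01' : c \in `[0 : R, 1]%classic by rewrite inE.
exists (exist _ c c01') => y.
rewrite -[leLHS]hg -[leRHS]hg; apply: cmax.
by have := valP y; rewrite inE.
Qed.

Lemma maxnorm_attained (f : C01) : exists x, `|f x| = maxnorm f.
Proof.
have [x xmax] := C01_max_attained f; exists x; apply/eqP.
rewrite eq_le; apply/andP; split.
  by apply: ub_le_sup; [exists `|f x| => _ [y _ <-]|exists x].
by apply: ge_sup; [exists `|f x|, x|move=> _ [y _ <-]].
Qed.

Lemma ler_maxnorm (f : C01) x : `|f x| <= maxnorm f.
Proof.
have [y ymax] := C01_max_attained f.
by apply: ub_le_sup; [exists `|f y| => _ [z _ <-]|exists x].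
Qed.

Fact maxnormD (f g : C01) : maxnorm (f + g) <= maxnorm f + maxnorm g.
Proof.
have [x <-] := maxnorm_attained (f + g).
by rewrite (le_trans (ler_normD _ _))// lerD// ler_maxnorm.
Qed.

Fact maxnormZ (a : R) (f : C01) : maxnorm (a *: f) = `|a| * maxnorm f.
Proof.
apply/eqP; rewrite eq_le; apply/andP; split.
  have [x <-] := maxnorm_attained (a *: f).
  by rewrite normrM ler_wpM2l// ler_maxnorm.
have [x <-] := maxnorm_attained f.
by rewrite -normrM; exact: ler_maxnorm (a *: f) x.
Qed.

Fact maxnorm0_eq0 (f : C01) : maxnorm f = 0 -> f = 0.
Proof.
move=> f0; apply/val_inj/funext => x; apply/eqP.
by rewrite -normr_le0 -f0 ler_maxnorm.
Qed.

HB.instance Definition _ :=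
  Lmodule_isNormed.Build R C01 maxnormD maxnormZ maxnorm0_eq0.

End C01.

Section rca.
Variable R : realType.
Implicit Types mu : set (I01 R) -> R.

Definition regular_setfun mu := forall A : set (I01 R), measurable A ->
  forall e : R, 0 < e -> exists F G : set (I01 R),
    [/\ closed F, open G, F `<=` A, A `<=` G &
      forall B, measurable B -> B `<=` G `\` F -> `|mu B| < e].

(* Only the values on Borel sets are meaningful; the first clause fixes the  *)
(* others, so that equality of elements is equality of measures.             *)
Definition is_rca : {pred set (I01 R) -> R} := [pred mu | `[< [/\
  forall A : set (I01 R), ~ measurable A -> mu A = 0,
  mu set0 = 0,
  semi_sigma_additive (EFin \o mu) & regular_setfun mu] >]].

Record rca : predArgType :=
  MkRca { rca_fun :> set (I01 R) -> R ; _ : rca_fun \in is_rca }.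

HB.instance Definition _ := [isSub for rca_fun].
HB.instance Definition _ := [Choice of rca by <:].

Fact is_rca_submod_closed : submod_closed is_rca.
Proof.
split.
  apply/asboolP; split => //=.
    move=> F mF tF mUF; rewrite [X in X @ _ --> _](_ : _ = fun=> 0%E).
      exact: cvg_cst.
    by apply/funext => n; rewrite big1.
  move=> A mA e e0; exists set0, setT; split => //; first exact: closed0.
    exact: openT.
  by move=> B _ _; rewrite normr0.
move=> a m n /asboolP[mN m0 ms mr] /asboolP[nN n0 ns nr]; apply/asboolP.
split => [A nA| | |].
- by rewrite !fctE mN// nN// scaler0 addr0.
- by rewrite !fctE m0 n0 scaler0 addr0.
- have cE0 (k : set (I01 R) -> R) : k set0 = 0 -> (EFin \o k) set0 = 0%E.
    by move=> /= ->.
  have cEf (k : set (I01 R) -> R) A : measurable A -> (EFin \o k) A \is a fin_num.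
    by [].
  pose mc : {charge set (I01 R) -> \bar R} := HB.pack (EFin \o m)
    (isCharge.Build _ _ _ (EFin \o m) (cE0 _ m0) (cEf m) ms).
  pose nc : {charge set (I01 R) -> \bar R} := HB.pack (EFin \o n)
    (isCharge.Build _ _ _ (EFin \o n) (cE0 _ n0) (cEf n) ns).
  exact: (@charge_semi_sigma_additive _ _ _ (cadd (cscale a mc) nc)).
- move=> A mA e e0.
  have d0 : 0 < e / 2 / (`|a| + 1) by rewrite !divr_gt0// ltr_wpDl.
  have [F [G [cF oG FA AG FGm]]] := mr A mA _ d0.
  have e20 : 0 < e / 2 by rewrite divr_gt0.
  have [F' [G' [cF' oG' FA' AG' FGn]]] := nr A mA _ e20.
  exists (F `|` F'), (G `&` G'); split.
  + exact: closedU.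
  + exact: openI.
  + by rewrite subUset.
  + by rewrite subsetI.
  + move=> B mB BFG; rewrite !fctE (le_lt_trans (ler_normD _ _))//.
    rewrite (splitr e) ler_ltD//; last first.
      by apply: FGn => // x /BFG[[_ ?] /not_orP[_ ?]].
    rewrite normrM (@le_trans _ _ (`|a| * (e / 2 / (`|a| + 1))))//.
      rewrite ler_wpM2l// ltW//.
      by apply: FGm => // x /BFG[[? _] /not_orP[? _]].
    by rewrite mulrCA ler_piMr ?ltW// ltr_pdivrMr ?mul1r ?ltrDl// ltr_wpDl.
Qed.

HB.instance Definition _ :=
  GRing.isSubmodClosed.Build R _ is_rca is_rca_submod_closed.
HB.instance Definition _ := [SubChoice_isSubLmodule of rca by <:].

Lemma rcaP (mu : rca) : [/\
  forall A : set (I01 R), ~ measurable A -> mu A = 0,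
  mu set0 = 0,
  semi_sigma_additive (EFin \o mu) & regular_setfun mu].
Proof. by case: mu => m /= /asboolP. Qed.

Lemma rcaDE (mu nu : rca) A : (mu + nu) A = mu A + nu A.
Proof. by []. Qed.

Lemma rcaZE (a : R) (mu : rca) A : (a *: mu) A = a * mu A.
Proof. by []. Qed.

Definition rca_charge (mu : rca) : set (I01 R) -> \bar R := EFin \o mu.

Section charge.
Variable mu : rca.

Fact rca_charge0 : rca_charge mu set0 = 0%E.
Proof. by have [_ m0 _ _] := rcaP mu; rewrite /rca_charge /= m0. Qed.

Fact rca_charge_finite A : measurable A -> rca_charge mu A \is a fin_num.
Proof. by []. Qed.

Fact rca_charge_sigma_additive : semi_sigma_additive (rca_charge mu).
Proof. by have [] := rcaP mu. Qed.

HB.instance Definition _ := isCharge.Build _ _ _ (rca_charge mu)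
  rca_charge0 rca_charge_finite rca_charge_sigma_additive.

End charge.


Definition hahn_pos (mu : rca) : set (I01 R) :=
  sval (cid (Hahn_decomposition (rca_charge mu))).

Definition hahn_neg (mu : rca) : set (I01 R) :=
  sval (cid (svalP (cid (Hahn_decomposition (rca_charge mu))))).

Definition hahnP (mu : rca) :
    hahn_decomposition (rca_charge mu) (hahn_pos mu) (hahn_neg mu) :=
  svalP (cid (svalP (cid (Hahn_decomposition (rca_charge mu))))).

Lemma measurable_hahn_pos (mu : rca) : measurable (hahn_pos mu).
Proof. by have [[]] := hahnP mu. Qed.

Lemma hahn_negE (mu : rca) : hahn_neg mu = ~` hahn_pos mu.
Proof.
have [_ _ PN NP] := hahnP mu; apply/seteqP; split=> x.
  by move=> Nx Px; have : set0 x by rewrite -NP.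
by move=> nPx; have : [set: I01 R] x by []; rewrite -PN => -[].
Qed.

Definition tvnorm (mu : rca) : R :=
  fine (charge_variation (hahnP mu) [set: I01 R]).

Lemma tvnormE (mu : rca) : tvnorm mu = mu (hahn_pos mu) - mu (hahn_neg mu).
Proof.
rewrite /tvnorm /charge_variation jordan_posE cjordan_posE jordan_negE.
by rewrite cjordan_negE /crestr0 mem_set// /crestr !setTI.
Qed.

Lemma tvnorm_ub (mu : rca) (A : set (I01 R)) :
  measurable A -> mu A - mu (~` A) <= tvnorm mu.
Proof.
move=> mA; have mCA : measurable (~` A) by exact: measurableC.
have v1 := abse_charge_variation (hahnP mu) mA.
have v2 := abse_charge_variation (hahnP mu) mCA.
have vT := measureU (charge_variation (hahnP mu)) mA mCA (setICr A).
rewrite setUCr in vT.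
have fA : charge_variation (hahnP mu) A \is a fin_num by exact: fin_num_measure.
have fC : charge_variation (hahnP mu) (~` A) \is a fin_num by exact: fin_num_measure.
rewrite /tvnorm vT fineD//.
move: v1 v2; rewrite -(fineK fA) -(fineK fC) !lee_fin => v1 v2.
apply: lerD; first exact: le_trans (ler_norm _) v1.
by apply: le_trans v2; rewrite -[leRHS]normrN; exact: ler_norm.
Qed.

Fact tvnormD (mu nu : rca) : tvnorm (mu + nu) <= tvnorm mu + tvnorm nu.
Proof.
have [[mP _] _ PN PN0] := hahnP (mu + nu).
have -> : tvnorm (mu + nu) = (mu (hahn_pos (mu + nu)) - mu (hahn_neg (mu + nu)))
    + (nu (hahn_pos (mu + nu)) - nu (hahn_neg (mu + nu))).
  by rewrite tvnormE !rcaDE opprD addrACA.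
have -> : hahn_neg (mu + nu) = ~` hahn_pos (mu + nu).
  exact: hahn_negE.
by rewrite lerD// tvnorm_ub.
Qed.

Fact tvnormZ (a : R) (mu : rca) : tvnorm (a *: mu) = `|a| * tvnorm mu.
Proof.
have le k nu : tvnorm (k *: nu) <= `|k| * tvnorm nu.
  have mP := measurable_hahn_pos (k *: nu).
  rewrite tvnormE hahn_negE !rcaZE -mulrBr.
  have [k0|k0] := leP 0 k; first by rewrite ger0_norm// ler_wpM2l// tvnorm_ub.
  rewrite ltr0_norm// -mulrNN opprB ler_wpM2l ?oppr_ge0 ?(ltW k0)//.
  by have := tvnorm_ub nu (measurableC mP); rewrite setCK.
apply/eqP; rewrite eq_le le /=; have [->|a0] := eqVneq a 0.
  by rewrite normr0 mul0r (le_trans _ (tvnorm_ub _ measurableT))// scale0r subr0.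
have := le a^-1 (a *: mu).
by rewrite scalerA mulVf// scale1r normfV ler_pdivlMl// normr_gt0.
Qed.

Fact tvnorm0_eq0 (mu : rca) : tvnorm mu = 0 -> mu = 0.
Proof.
move=> mu0; apply/val_inj/funext => A /=.
have [mA|nmA] := pselect (measurable A); last first.
  by have [/(_ A nmA)] := rcaP mu.
have := abse_charge_variation (hahnP mu) mA.
have AT : (charge_variation (hahnP mu) A <= charge_variation (hahnP mu) setT)%E.
  by apply: le_measure => //; rewrite inE.
move=> /le_trans/(_ AT).
have fT : charge_variation (hahnP mu) setT \is a fin_num by exact: fin_num_measure.
by rewrite -(fineK fT) -/(tvnorm mu) mu0 lee_fin normr_le0 => /eqP.
Qed.

HB.instance Definition _ :=
  Lmodule_isNormed.Build R rca tvnormD tvnormZ tvnorm0_eq0.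

End rca.

Section dual.
Variables (R : realType) (V : normedModType R).

Definition is_dual : {pred V -> R} :=
  [pred phi : V -> R | `[< scalar phi /\ continuous phi >]].

Record dual : predArgType :=
  MkDual { dual_fun :> V -> R ; _ : dual_fun \in is_dual }.

HB.instance Definition _ := [isSub for dual_fun].
HB.instance Definition _ := [Choice of dual by <:].

Fact is_dual_submod_closed : submod_closed is_dual.
Proof.
split.
  apply/asboolP; split => [a x y|x]; last exact: cst_continuous.
  by rewrite /= mulr0 addr0.
move=> a f g /asboolP[lf cf] /asboolP[lg cg]; apply/asboolP; split => [b x y|x].
  rewrite -[LHS]/(a * f (b *: x + y) + g (b *: x + y)).
  rewrite -[RHS]/(b * (a * f x + g x) + (a * f y + g y)) lf lg.
  by rewrite !mulrDr addrACA mulrCA.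
apply: (@continuousD R R V) (cg x).
exact: (@continuousZl_tmp R R V) (cf x).
Qed.

HB.instance Definition _ :=
  GRing.isSubmodClosed.Build R _ is_dual is_dual_submod_closed.
HB.instance Definition _ := [SubChoice_isSubLmodule of dual by <:].

End dual.

Section duality_mapping.
Variable R : realType.

(* The integral of f against the signed measure mu. *)
Definition pairing (mu : rca R) (f : C01 R) : R :=
  \int[jordan_pos (hahnP mu)]_x f x - \int[jordan_neg (hahnP mu)]_x f x.

Definition J (f : C01 R) : set (rca R) :=
  [set mu | pairing mu f = `|f| ^+ 2 /\ `|f| ^+ 2 = `|mu| ^+ 2].

Definition graph_J : set (C01 R * rca R) := [set p | J p.1 p.2].

Definition mordukhovich_quotient (f : C01 R) (mu : rca R)
    (Phi : dual (rca R)) (lam : rca R) (p : C01 R * rca R) : R :=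
  (pairing lam (p.1 - f) - Phi (p.2 - mu)) / (`|p.1 - f| + `|p.2 - mu|).

(* The filter is that of punctured neighbourhoods of (f, mu) in the product  *)
(* of the norm topologies, restricted to the graph of J.                     *)
Definition DJ (f : C01 R) (mu : rca R) (Phi : dual (rca R)) : set (rca R) :=
  [set lam | (limf_esup (EFin \o mordukhovich_quotient f mu Phi lam)
                (within graph_J (f, mu)^') <= 0)%E].

End duality_mapping.

(* Main.v *)
Require Import Defs.
From mathcomp Require Import all_boot all_order all_algebra.
From mathcomp Require Import all_classical all_reals all_analysis.
From mathcomp Require Import measurable_realfun lra.

Import Order.TTheory GRing.Theory Num.Theory.
Import numFieldNormedType.Exports.

Local Open Scope classical_set_scope.
Local Open Scope ring_scope.

(** Adding a constant [s] to [f] changes [f] by [|s|] in norm, while [lam] pairs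
    with that change to [s * lam [0,1]].  With [c = lam [0,1]] and [s = t * c],
    [t > 0], the numerator of the quotient with [Phi = 0] is therefore
    [t * c ^ 2], which is positive.  It remains to follow [f + t * c] by
    elements of the duality mapping that move at a comparable speed.

    If [|f|] attains its maximum at [x], then the multiple [f x] of the Dirac
    mass at [x] belongs to [J f] ([J_dirac]).  So it is enough to choose a point
    [x] that is a point of maximum modulus of [f + t * c] for all small
    [t >= 0] at once ([norming_point]): then [(f x + t * c)] times the Dirac
    mass at [x] lies in [J (f + t * c)] and is at distance exactly [t * |c|]
    from [f x] times that mass.  The quotient equals [|c| / 2] along the whole
    path, so the limsup is positive ([notin_DJ_dirac]).

    The duality mapping sends [0] to [{0}] only, so the second assertion is the
    first one at [f = 0]. *)

(** * Dirac masses as elements of [rca] *)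

Lemma closed_I01_set1 {R : realType} (x : I01 R) : closed [set x].
Proof.
have -> : [set x] = (val : I01 R -> R) @^-1` [set val x].
  by apply/seteqP; split=> y /= => [->//|/val_inj].
have /continuousP := @initial_continuous _ _ (val : I01 R -> R).
move=> cv; rewrite -openC preimage_setC; apply: cv.
rewrite openC; apply: accessible_closed_set1.
exact: hausdorff_accessible (@Rhausdorff R).
Qed.

Lemma measurable_I01_set1 {R : realType} (x : I01 R) : measurable [set x].
Proof.
rewrite -[X in measurable X]setCK; apply: measurableC.
by apply: sub_sigma_algebra; rewrite /= openC; exact: closed_I01_set1.
Qed.

Lemma measurable_C01 {R : realType} (f : C01 R) : measurable_fun setT f.
Proof.
have /continuousP cf := @C01_continuous R f.
move=> mD; apply: (measurability _ (RGenOpens.measurableE R)) => //.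
move=> _ [_ [a [b ->] <-]]; rewrite setTI; apply: sub_sigma_algebra.
exact/cf/interval_open.
Qed.

(** The Dirac mass, set to zero off the Borel sets as elements of [rca] are
    required to be. *)
Definition dirac_setfun {R : realType} (x : I01 R) (A : set (I01 R)) : R :=
  if A \in measurable then \1_A x else 0.

Lemma dirac_setfunE {R : realType} (x : I01 R) (A : set (I01 R)) :
  measurable A -> dirac_setfun x A = \1_A x.
Proof. by move=> mA; rewrite /dirac_setfun mem_set. Qed.

Lemma dirac_setfun_out {R : realType} (x : I01 R) (A : set (I01 R)) :
  ~ A x -> dirac_setfun x A = 0.
Proof. by move=> Ax; rewrite /dirac_setfun indicE memNset//; case: ifP. Qed.

(** For regularity, [A] is approximated from inside by [{x}] and from outside by the
    whole interval if [x] is in [A], and by the empty set and the complement of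
    [{x}] otherwise; both gaps avoid [x]. *)
Lemma dirac_setfun_rca {R : realType} (x : I01 R) :
  dirac_setfun x \in @is_rca R.
Proof.
apply/asboolP; split.
- by move=> A mA; rewrite /dirac_setfun memNset.
- by apply: dirac_setfun_out.
- move=> F mF tF mUF.
  rewrite /= dirac_setfunE// -[X in _ --> X]/(\d_x (\bigcup_n F n)).
  rewrite [X in X @ _ --> _](_ : _ =
      fun n => (\sum_(0 <= i < n) \d_x (F i))%E); last first.
    by apply/funext => n; apply: eq_bigr => i _; rewrite /= dirac_setfunE.
  exact: measure_semi_sigma_additive.
- move=> A mA e e0; have [Ax|Ax] := pselect (A x).
    exists [set x], setT; split => //; first exact: closed_I01_set1.
    - exact: openT.
    - by move=> _ ->.
    - by move=> B mB BA; rewrite dirac_setfun_out ?normr0// => /BA[_]; exact.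
  exists set0, (~` [set x]); split => //; first exact: closed0.
  - by rewrite openC; exact: closed_I01_set1.
  - by move=> y Ay yx; apply: Ax; rewrite -yx.
  - by move=> B mB BA; rewrite dirac_setfun_out ?normr0// => /BA[+ _]; exact.
Qed.

Definition dirac_rca {R : realType} (x : I01 R) : rca R :=
  MkRca (dirac_setfun_rca x).

Lemma norm_dirac_rca {R : realType} (x : I01 R) : `|dirac_rca x| = 1.
Proof.
rewrite -[LHS]/(tvnorm (dirac_rca x)); apply/eqP; rewrite eq_le.
apply/andP; split.
  rewrite tvnormE /= !dirac_setfunE ?hahn_negE; first last.
  - exact: measurable_hahn_pos.
  - by apply: measurableC; exact: measurable_hahn_pos.
  by rewrite !indicE; do 2 case: (_ \in _) => //=; lra.
have := tvnorm_ub (dirac_rca x) measurableT.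
by rewrite /= setCT !dirac_setfunE// !indicE in_setT in_set0 subr0.
Qed.

(** * Pairing with constants and with Dirac masses *)

Lemma cst_is_C01 {R : realType} (a : R) : (fun _ : I01 R => a) \in @is_C01 R.
Proof. by apply/asboolP => x; exact: cst_continuous. Qed.

Definition cst01 {R : realType} (a : R) : C01 R := MkC01 (cst_is_C01 a).

Lemma norm_cst01 {R : realType} (a : R) : `|cst01 a| = `|a|.
Proof. by have [x /esym] := maxnorm_attained (cst01 a). Qed.

Lemma pairing_cst01 {R : realType} (mu : rca R) (a : R) :
  pairing mu (cst01 a) = a * mu setT.
Proof.
rewrite /pairing !Rintegral_cst// -mulrBr; congr (_ * _).
have := congr1 fine (jordan_decomp (hahnP mu) measurableT).
rewrite /cadd /= cscaleN1.
have fp : jordan_pos (hahnP mu) setT \is a fin_num by exact: fin_num_measure.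
have fn : jordan_neg (hahnP mu) setT \is a fin_num by exact: fin_num_measure.
by rewrite fineB.
Qed.

(** Both Jordan parts of [mu] vanish on a set all of whose measurable subsets are
    [mu]-null, since they are restrictions of [mu] and [- mu]; so the two
    integrals agree part by part. *)
Lemma eq_pairing {R : realType} (mu : rca R) (f g : C01 R) (N : set (I01 R)) :
  measurable N -> (forall A, measurable A -> A `<=` N -> mu A = 0) ->
  (forall x, ~ N x -> f x = g x) -> pairing mu f = pairing mu g.
Proof.
move=> mN muN fg.
have eqi (m : {measure set (I01 R) -> \bar R}) : m N = 0%E ->
    \int[m]_x f x = \int[m]_x g x.
  move=> mN0; rewrite /Rintegral; congr fine; apply: ae_eq_integral => //.
  - by apply/measurable_EFinP; exact: measurable_C01.
  - by apply/measurable_EFinP; exact: measurable_C01.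
  - exists N; split => // y /= nfg; apply: contrapT => Ny; apply: nfg => _.
    by rewrite fg.
have [mP mC] := (measurable_hahn_pos mu, measurableC (measurable_hahn_pos mu)).
have posN : jordan_pos (hahnP mu) N = 0%E.
  rewrite jordan_posE cjordan_posE /crestr0 mem_set// /crestr /=.
  congr EFin; apply: muN; [exact: measurableI|exact: subIsetl].
have negN : jordan_neg (hahnP mu) N = 0%E.
  rewrite jordan_negE cjordan_negE /crestr0 mem_set// /crestr /=.
  rewrite -[RHS]oppe0; congr (- EFin _)%E; apply: muN; last exact: subIsetl.
  by apply: measurableI => //; rewrite hahn_negE.
by congr (_ - _); exact: eqi.
Qed.

(** Replacing [f] by the constant [f x], which changes it only off [{x}], avoids
    computing the Jordan decomposition of the mass according to the sign of
    [a]. *)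
Lemma pairing_dirac {R : realType} (a : R) (x : I01 R) (f : C01 R) :
  pairing (a *: dirac_rca x) f = f x * a.
Proof.
rewrite (@eq_pairing _ _ f (cst01 (f x)) (~` [set x])).
- by rewrite pairing_cst01 rcaZE /= dirac_setfunE// indicE in_setT mulr1.
- by apply: measurableC; exact: measurable_I01_set1.
- move=> A mA AN; rewrite rcaZE /= dirac_setfun_out ?mulr0// => /AN; exact.
- by move=> y /contrapT ->.
Qed.

Lemma J_dirac {R : realType} (f : C01 R) (x : I01 R) :
  `|f x| = `|f| -> J f (f x *: dirac_rca x).
Proof.
move=> fx; split; last by rewrite normrZ norm_dirac_rca mulr1 fx.
by rewrite pairing_dirac -fx real_normK ?num_real.
Qed.

(** * Points of maximum modulus under a constant shift *)

Lemma C01_norm_leP {R : realType} (f : C01 R) (a : R) :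
  (forall x, `|f x| <= a) -> `|f| <= a.
Proof.
by move=> fa; have [x] := maxnorm_attained f; rewrite -[`|f|]/(maxnorm f) => <-.
Qed.

Lemma ler_C01_norm {R : realType} (f : C01 R) x : `|f x| <= `|f|.
Proof. exact: ler_maxnorm. Qed.

(** If some point [x] of maximum modulus has [f x] of the same sign as [c], then
    the triangle inequality is an equality at [x] and [t] is unrestricted.
    Otherwise [f] takes the value of maximum modulus with the sign opposite to
    [c] only, at [x] say, and by compactness keeps a positive distance to
    [- f x]; shifting by [t * c] lowers the modulus at [x], and [x] remains the
    maximum as long as the other side has not caught up. *)
Lemma norming_point {R : realType} (f : C01 R) (c : R) : exists x,
  `|f x| = `|f| /\
  exists2 d, 0 < d &
    forall t, 0 < t < d -> `|f x + t * c| = `|f + cst01 (t * c)|.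
Proof.
have [[x fx fxc]|nfc] := pselect (exists2 x, `|f x| = `|f| & 0 <= f x * c).
  exists x; split => //; exists 1 => // t /andP[t0 _].
  apply/eqP; rewrite eq_le (ler_C01_norm (f + cst01 (t * c)) x) /=.
  rewrite (le_trans (ler_normD _ _))// norm_cst01 -fx.
  have : 0 <= f x * (t * c) by rewrite mulrCA mulr_ge0// ltW.
  have [f0|f0] := leP 0 (f x); have [b0|b0] := leP 0 (t * c) => h.
  - by rewrite !ger0_norm// addr_ge0.
  - have : f x = 0 by nra.
    by move=> ->; rewrite normr0 !add0r.
  - have : t * c = 0 by nra.
    by move=> ->; rewrite normr0 !addr0.
  - by rewrite !ltr0_norm ?opprD//; lra.
have [x fx] : exists x, `|f x| = `|f| by exact: maxnorm_attained.
have fxc : f x * c < 0.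
  by rewrite ltNge; apply/negP => fxc; apply: nfc; exists x.
exists x; split => //.
(* The range of [f] lies between [f x] and [- f x]; its largest distance to
   [f x], attained at [y], falls short of the full length [2 * |f x|]. *)
have [y gy] := maxnorm_attained (f - cst01 (f x)).
have gy2 : `|f y - f x| < `|f x| + `|f x|.
  have fyx : `|f y| <= `|f x| by rewrite fx ler_C01_norm.
  rewrite lt_neqAle (le_trans (ler_normB _ _)) ?lerD// andbT.
  apply/negP => /eqP e; apply: nfc; exists y.
    apply/eqP; rewrite -fx eq_le fyx /= -(lerD2r `|f x|) -e.
    exact: ler_normB.
  suff : f y = - f x by move=> ->; rewrite mulNr oppr_ge0 ltW.
  move: e fyx; rewrite ler_norml.
  case: (ger0P (f x)) => fx0; case: (ger0P (f y - f x)) => d0 e /andP[fy1 fy2];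
    lra.
have c0 : 0 < `|c| by rewrite normr_gt0; apply: contraTneq fxc => ->; lra.
(* The shift eats up the gap from both ends, hence the factor 2. *)
exists ((`|f x| + `|f x| - `|f y - f x|) / (2 * `|c|)).
  by rewrite divr_gt0 ?mulr_gt0// subr_gt0.
move=> t /andP[t0]; rewrite ltr_pdivlMr ?mulr_gt0// => tc.
apply/eqP; rewrite eq_le (ler_C01_norm (f + cst01 (t * c)) x) /=.
apply: C01_norm_leP => z.
have : `|f z - f x| <= `|f y - f x|.
  by have := ler_maxnorm (f - cst01 (f x)) z; rewrite -gy.
have : `|f z| <= `|f x| by rewrite fx ler_C01_norm.
rewrite -[(_ + cst01 _) z]/(f z + t * c) !ler_norml.
move: gy2 tc; set M := `|f y - f x| => gy2 tc /andP[h1 h2] /andP[h3 h4].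
have [c0'|c0'] := leP 0 c.
  have fx0 : f x < 0 by nra.
  move: gy2 tc h1 h2; rewrite (ltr0_norm fx0) (ger0_norm c0') => gy2 tc h1 h2.
  have := ler_norm (- (f x + t * c)); rewrite normrN => h5.
  apply/andP; split; lra.
have fx0 : 0 < f x by nra.
move: gy2 tc h1 h2; rewrite (gtr0_norm fx0) (ltr0_norm c0') => gy2 tc h1 h2.
have := ler_norm (f x + t * c) => h5.
apply/andP; split; lra.
Qed.

(** * Positivity of the limsup *)

(** With [c = lam [0,1]], the quotient is constantly [|c| / 2] along the path of
    the pairs [(f + t * c, (f x + t * c) *: dirac_rca x)], which meets every
    punctured neighbourhood of the base point within the graph of the duality
    mapping. *)
Lemma notin_DJ_dirac {R : realType} (lam : rca R) (f : C01 R) (x : I01 R)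
    (d : R) :
  lam setT <> 0 -> `|f x| = `|f| -> 0 < d ->
  (forall t, 0 < t < d ->
    `|f x + t * lam setT| = `|f + cst01 (t * lam setT)|) ->
  lam \notin DJ f (f x *: dirac_rca x) 0.
Proof.
set c := lam setT => /eqP c0 fx d0 fxt; apply/negP; rewrite inE => /le_lt_trans.
have cgt0 : 0 < `|c| by rewrite normr_gt0.
have c2gt0 : (0 < (`|c| / 2)%:E)%E by rewrite lte_fin divr_gt0.
move/(_ _ c2gt0); apply/negP; rewrite -leNgt; apply/ereal_infP => _ [V FV <-].
have /nbhs_ballP [e /= e0 eV] : nbhs (f, f x *: dirac_rca x)
  [set p | p != (f, f x *: dirac_rca x) -> graph_J p -> V p] by [].
pose t := Num.min d (e / `|c|) / 2.
have t0 : 0 < t by rewrite divr_gt0// lt_min d0 divr_gt0.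
have td : t < d.
  by rewrite ltr_pdivrMr// gt_min; apply/orP; left; lra.
have te : t * `|c| < e.
  rewrite -ltr_pdivlMr// ltr_pdivrMr// gt_min; apply/orP; right.
  by rewrite ltr_pMr ?divr_gt0// ltr1n.
have ntc : `|t * c| = t * `|c| by rewrite normrM gtr0_norm.
pose g : C01 R := f + cst01 (t * c).
pose gam : rca R := g x *: dirac_rca x.
have ng : `|g - f| = t * `|c| by rewrite [g]addrC addrK norm_cst01.
have ngam : `|gam - f x *: dirac_rca x| = t * `|c|.
  rewrite -scalerBl normrZ norm_dirac_rca mulr1.
  by rewrite [g x](_ : _ = f x + t * c)// addrC addKr.
have Vg : V (g, gam).
  apply: eV.
  - split => /=; rewrite -ball_normE /= -normrN opprB; last by rewrite ngam.
    by rewrite ng.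
  - apply/eqP => -[gf _]; move: ng; rewrite gf subrr normr0 => /esym/eqP.
    by rewrite mulf_eq0 !gt_eqF.
  - by apply: J_dirac; rewrite -fxt ?t0.
apply: le_ereal_sup_tmp.
exists (mordukhovich_quotient f (f x *: dirac_rca x) 0 lam (g, gam))%:E.
  by exists (g, gam).
rewrite lee_fin /mordukhovich_quotient /= ng ngam.
rewrite (_ : g - f = cst01 (t * c)); last by rewrite [g]addrC addrK.
have tc0 : 0 < t * `|c| by exact: mulr_gt0.
rewrite pairing_cst01 -/c subr0 ler_pdivlMr ?addr_gt0//.
have : `|c| * `|c| = c * c by rewrite -normrM ger0_norm// -expr2 sqr_ge0.
nra.
Qed.

Theorem theorem5p5 (R : realType) (lam : rca R) :
  lam [set: I01 R] <> 0 ->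
  (forall f : C01 R, exists mu : rca R, mu \in J f /\ lam \notin DJ f mu 0) /\
  lam \notin DJ 0 0 0.
Proof.
move=> lam0.
have main f : exists mu : rca R, mu \in J f /\ lam \notin DJ f mu 0.
  have [x [fx [d d0 fxt]]] := norming_point f (lam setT).
  exists (f x *: dirac_rca x); split; first by rewrite inE; exact: J_dirac.
  exact: notin_DJ_dirac fxt.
split => //; have [mu [/set_mem[_]]] := main 0.
rewrite normr0 expr0n /= => /esym/eqP.
by rewrite sqrf_eq0 normr_eq0 => /eqP ->.
Qed.
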